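(* Let $\mathfrak{g}$ be a Lie algebra with a fixed triangular decomposition $\mathfrak{g}=\mathfrak{n}_-\oplus\mathfrak{h}\oplus\mathfrak{n}_+$ in the sense of Moody–Pianzola and set $\mathfrak{n}=\mathfrak{n}_+$. Assume that $\mu\in \mathfrak{h}^*$ is such that the Verma module $M(\mu)$ is simple and let $\lambda\in(\mathfrak{n}/[\mathfrak{n},\mathfrak{n}])^*$. Then $\mathrm{Ann}_{U(\mathfrak{g})}L(\lambda,\mu)=\mathrm{Ann}_{U(\mathfrak{g})}M(\mu)$.
   Context: Everything is over $\mathbb{C}$; $\mathfrak{g}$ may be infinite dimensional, of at most countable dimension. Triangular decomposition in the sense of Moody–Pianzola: $\mathfrak{g}=\mathfrak{n}_-\oplus\mathfrak{h}\oplus\mathfrak{n}_+$ as vector spaces, where $\mathfrak{h}\ne0$ is an abelian subalgebra and $\mathfrak{n}_\pm$ are nonzero subalgebras stable under $\mathrm{ad}\,\mathfrak{h}$; $\mathfrak{n}_+$ is the direct sum of its $\mathfrak{h}$-weight spaces, with all weights in $Q_+\setminus\{0\}$, where $Q_+\subset\mathfrak{h}^*$ is the additive monoid generated by some linearly independent subset of $\mathfrak{h}^*$; and there is an involutive anti-automorphism $\sigma$ of $\mathfrak{g}$ with $\sigma(\mathfrak{n}_+)=\mathfrak{n}_-$ and $\sigma|_{\mathfrak{h}}=\mathrm{id}$. $M(\mu)=U(\mathfrak{g})\otimes_{U(\mathfrak{h}\oplus\mathfrak{n}_+)}\mathbb{C}_\mu$ is the Verma module, where $\mathfrak{n}_+$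 acts by $0$ and $h\in\mathfrak{h}$ by $\mu(h)$ on the one-dimensional space $\mathbb{C}_\mu$. Elements of $(\mathfrak{n}/[\mathfrak{n},\mathfrak{n}])^*$ are identified with Lie algebra homomorphisms $\mathfrak{n}\to\mathbb{C}$. For a $\mathfrak{g}$-module $M$, $W_\lambda(M)=\{v\in M: xv=\lambda(x)v\text{ for all }x\in\mathfrak{n}\}$. $L_\lambda=\langle v_\lambda\rangle$ is the one-dimensional $\mathfrak{n}$-module given by $\lambda$, and $M_\lambda=U(\mathfrak{g})\otimes_{U(\mathfrak{n})}L_\lambda$. $N(-\mu)=U(\mathfrak{g})\otimes_{U(\mathfrak{h}\oplus\mathfrak{n}_-)}\mathbb{C}_{-\mu}$ is the lowest weight Verma module, where $\mathfrak{n}_-$ acts by $0$ and $h\in\mathfrak{h}$ by $-\mu(h)$ on the one-dimensional space $\mathbb{C}_{-\mu}$. Its full dual space $N(-\mu)^*$ is a $\mathfrak{g}$-module via $(xf)(v)=f(-xv)$. For all $\lambda,\mu$ the space $W_\lambda(N(-\mu)^* )$ is one-dimensional, so there is a unique (up to scalar) nonzero homomorphism $M_\lambda\to N(-\mu)^*$; it sends $1\otimes v_\lambda$ to a nonzero vector of $W_\lambda(N(-\mu)^* )$. $L(\lambda,\mu)$ denotes the image of this homomorphism. *)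

(* Defs.v *)
From HB Require Import structures.
From mathcomp Require Import all_boot all_order all_algebra.
From mathcomp Require Import boolp classical_sets functions cardinality reals.
From mathcomp Require Import complex.

Set Implicit Arguments.
Unset Strict Implicit.
Unset Printing Implicit Defensive.

Import GRing.Theory.
Local Open Scope ring_scope.
Local Open Scope quotient_scope.
Local Open Scope classical_set_scope.

Reserved Notation "[ 'Lie' x , y ]" (at level 0, x, y at level 99,
  format "[ 'Lie'  x ,  y ]").

HB.mixin Record hasLieBracket (K : fieldType) g of GRing.Lmodule K g := {
  lie : g -> g -> g;
  lie_linearl : forall y, linear (lie^~ y);
  lie_linearr : forall x, linear (lie x);
  liexx : forall x, lie x x = 0;
  lie_jacobi : forall x y z,
    lie x (lie y z) + lie y (lie z x) + lie z (lie x y) = 0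
}.

#[short(type="lieAlgType")]
HB.structure Definition LieAlgebra (K : fieldType) :=
  {g of GRing.Lmodule K g & hasLieBracket K g}.

Notation "[ 'Lie' x , y ]" := (lie x y) : ring_scope.

Section LieTheory.
Variables (K : fieldType) (g : lieAlgType K).
Implicit Types x y z : g.

Lemma lieDl x y z : [Lie x + y, z] = [Lie x, z] + [Lie y, z].
Proof. by rewrite -[x in LHS]scale1r lie_linearl scale1r. Qed.

Lemma lieDr x y z : [Lie z, x + y] = [Lie z, x] + [Lie z, y].
Proof. by rewrite -[x in LHS]scale1r lie_linearr scale1r. Qed.

Lemma lieC x y : [Lie x, y] = - [Lie y, x].
Proof.
apply/eqP; rewrite -addr_eq0; apply/eqP.
by have := liexx (x + y); rewrite lieDl !lieDr !liexx add0r addr0.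
Qed.

End LieTheory.

HB.mixin Record isLieMorphism (K : fieldType) (g1 g2 : lieAlgType K)
    (f : g1 -> g2) := {
  lie_morphism_subproof : {morph f : x y / [Lie x, y]}
}.

#[short(type="lieHom")]
HB.structure Definition LieHom (K : fieldType) (g1 g2 : lieAlgType K) :=
  {f of @GRing.Linear K g1 g2 *:%R f & isLieMorphism K g1 g2 f}.

Section LieHomComp.
Variables (K : fieldType) (g1 g2 g3 : lieAlgType K).
Variables (f : lieHom g2 g3) (e : lieHom g1 g2).

Fact comp_lie_morphism : {morph f \o e : x y / [Lie x, y]}.
Proof. by move=> x y /=; rewrite !lie_morphism_subproof. Qed.

HB.instance Definition _ :=
  isLieMorphism.Build K g1 g3 (f \o e) comp_lie_morphism.

End LieHomComp.

(* The Lie algebra of an associative algebra, with the commutator bracket. *)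
Definition commLie (K : fieldType) (A : algType K) : Type := A.

Section CommLie.
Variables (K : fieldType) (A : algType K).

HB.instance Definition _ := GRing.Lmodule.on (commLie A).

Let br (a b : A) : A := a * b - b * a.

Fact commLie_linearl (y : A) : linear (br^~ y).
Proof.
move=> a u v; rewrite /br mulrDl mulrDr -scalerAl -scalerAr scalerBr opprD.
by rewrite addrACA.
Qed.

Fact commLie_linearr (x : A) : linear (br x).
Proof.
move=> a u v; rewrite /br mulrDl mulrDr -scalerAl -scalerAr scalerBr opprD.
by rewrite addrACA.
Qed.

Fact commLie_xx (x : A) : br x x = 0.
Proof. exact: subrr. Qed.

Fact commLie_jacobi (x y z : A) :
  br x (br y z) + br y (br z x) + br z (br x y) = 0.
Proof.
have brE u v w : br u (br v w) =
    (u * v * w + w * v * u) - (u * w * v + v * w * u).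
  by rewrite /br mulrBr mulrBl !mulrA opprB addrACA -opprD [X in _ - X]addrC.
rewrite !brE (addrC (x * z * y)) (addrC (y * x * z)) (addrC (z * y * x)).
by rewrite !subrKA subrr.
Qed.

HB.instance Definition _ := hasLieBracket.Build K (commLie A)
  commLie_linearl commLie_linearr commLie_xx commLie_jacobi.

End CommLie.

(* Characters of g, i.e. Lie algebra homomorphisms from g to the ground field,
   whose commutator bracket vanishes. *)
Definition lieChar (K : fieldType) (g : lieAlgType K) : Type :=
  lieHom g (commLie (K^o : algType K)).

HB.mixin Record isLieClosed (K : fieldType) (g : lieAlgType K)
    (S : {pred g}) := {
  lie_closed_subproof : {in S &, forall x y, [Lie x, y] \in S}
}.

#[short(type="lieSubalg")]
HB.structure Definition LieSubalg (K : fieldType) (g : lieAlgType K) :=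
  {S of @GRing.SubmodClosed K g S & isLieClosed K g S}.

Section SubLie.
Variables (K : fieldType) (g : lieAlgType K) (S : lieSubalg g).

Lemma sublie_rpredN x : x \in S -> - x \in S.
Proof. by move=> Sx; rewrite -scaleN1r rpredZ. Qed.

Lemma sublie_rpredB x y : x \in S -> y \in S -> x - y \in S.
Proof. by move=> Sx Sy; rewrite rpredD ?sublie_rpredN. Qed.

Record sublie : Type := Sublie { sublie_val : g; _ : sublie_val \in S }.

HB.instance Definition _ := [isSub for sublie_val].
HB.instance Definition _ := [Choice of sublie by <:].
HB.instance Definition _ := [SubChoice_isSubLmodule of sublie by <:].

Definition sublie_bracket (x y : sublie) : sublie :=
  Sublie (lie_closed_subproof _ _ (valP x) (valP y)).

Fact sublie_linearl y : linear (sublie_bracket^~ y).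
Proof. by move=> a u v; apply: val_inj; rewrite /= lie_linearl. Qed.

Fact sublie_linearr x : linear (sublie_bracket x).
Proof. by move=> a u v; apply: val_inj; rewrite /= lie_linearr. Qed.

Fact sublie_xx x : sublie_bracket x x = 0.
Proof. by apply: val_inj; rewrite /= liexx. Qed.

Fact sublie_jacobi x y z :
  sublie_bracket x (sublie_bracket y z) +
  sublie_bracket y (sublie_bracket z x) +
  sublie_bracket z (sublie_bracket x y) = 0.
Proof. by apply: val_inj; rewrite /= lie_jacobi. Qed.

HB.instance Definition _ := hasLieBracket.Build K sublie
  sublie_linearl sublie_linearr sublie_xx sublie_jacobi.

Definition sublie_incl (x : sublie) : g := sublie_val x.

Fact sublie_incl_linear : linear sublie_incl.
Proof. by []. Qed.
HB.instance Definition _ :=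
  GRing.isLinear.Build K sublie g *:%R sublie_incl sublie_incl_linear.

Fact sublie_incl_lie : {morph sublie_incl : x y / [Lie x, y]}.
Proof. by []. Qed.
HB.instance Definition _ :=
  isLieMorphism.Build K sublie g sublie_incl sublie_incl_lie.

End SubLie.

Section UEnv.
Variables (K : fieldType) (g : lieAlgType K).

(* U(g) is presented as the associative unital K-algebra with generators the
   elements x of g, subject to the linear relations of g and to the relations
   [x, y] = xy - yx: formal expressions modulo the congruence [ueq] generated
   by the axioms of algebras and by these relations. *)
Inductive uterm : Type :=
| UGen of g
| UCst of K
| UAdd of uterm & uterm
| UMul of uterm & uterm.

Inductive ueq : uterm -> uterm -> Prop :=
| ueq_refl s : ueq s s
| ueq_sym s t : ueq s t -> ueq t s
| ueq_trans s t u : ueq s t -> ueq t u -> ueq s u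
| ueq_add s s' t t' : ueq s s' -> ueq t t' -> ueq (UAdd s t) (UAdd s' t')
| ueq_mul s s' t t' : ueq s s' -> ueq t t' -> ueq (UMul s t) (UMul s' t')
| ueq_addA s t u : ueq (UAdd s (UAdd t u)) (UAdd (UAdd s t) u)
| ueq_addC s t : ueq (UAdd s t) (UAdd t s)
| ueq_add0 s : ueq (UAdd (UCst 0) s) s
| ueq_addN s : ueq (UAdd (UMul (UCst (-1)) s) s) (UCst 0)
| ueq_mulA s t u : ueq (UMul s (UMul t u)) (UMul (UMul s t) u)
| ueq_mul1l s : ueq (UMul (UCst 1) s) s
| ueq_mul1r s : ueq (UMul s (UCst 1)) s
| ueq_mulDl s t u : ueq (UMul (UAdd s t) u) (UAdd (UMul s u) (UMul t u))
| ueq_mulDr s t u : ueq (UMul s (UAdd t u)) (UAdd (UMul s t) (UMul s u))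
| ueq_cstD a b : ueq (UCst (a + b)) (UAdd (UCst a) (UCst b))
| ueq_cstM a b : ueq (UCst (a * b)) (UMul (UCst a) (UCst b))
| ueq_cstC a s : ueq (UMul (UCst a) s) (UMul s (UCst a))
| ueq_genP a x y :
    ueq (UGen (a *: x + y)) (UAdd (UMul (UCst a) (UGen x)) (UGen y))
| ueq_lie x y :
    ueq (UGen [Lie x, y])
        (UAdd (UMul (UGen x) (UGen y))
              (UMul (UCst (-1)) (UMul (UGen y) (UGen x)))).

HB.instance Definition _ := gen_eqMixin uterm.
HB.instance Definition _ := gen_choiceMixin uterm.

Definition ueqb (s t : uterm) : bool := `[< ueq s t >].

Fact ueqb_refl : reflexive ueqb.
Proof. by move=> s; apply/asboolP; apply: ueq_refl. Qed.
Fact ueqb_sym : symmetric ueqb.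
Proof. by move=> s t; apply/asboolP/asboolP; apply: ueq_sym. Qed.
Fact ueqb_trans : transitive ueqb.
Proof.
by move=> t s u /asboolP st /asboolP tu; apply/asboolP; apply: ueq_trans tu.
Qed.

Canonical ueqb_equiv := EquivRel ueqb ueqb_refl ueqb_sym ueqb_trans.

Definition uenv : Type := {eq_quot ueqb}.
HB.instance Definition _ := Choice.on uenv.

Definition uclass (s : uterm) : uenv := \pi_{eq_quot ueqb} s.
Definition urepr (u : uenv) : uterm := repr u.

Lemma uclassE s t : ueq s t -> uclass s = uclass t.
Proof. by move=> st; apply/eqmodP/asboolP. Qed.

Lemma uclass_inj s t : uclass s = uclass t -> ueq s t.
Proof. by move/eqmodP/asboolP. Qed.

Lemma ureprK : cancel urepr uclass.
Proof. exact: reprK. Qed.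

Lemma urepr_class s : ueq (urepr (uclass s)) s.
Proof. by apply: uclass_inj; rewrite ureprK. Qed.

Definition uadd (u v : uenv) : uenv := uclass (UAdd (urepr u) (urepr v)).
Definition umul (u v : uenv) : uenv := uclass (UMul (urepr u) (urepr v)).
Definition ucst (a : K) : uenv := uclass (UCst a).

Lemma uaddE s t : uadd (uclass s) (uclass t) = uclass (UAdd s t).
Proof. by apply/uclassE/ueq_add; apply: urepr_class. Qed.

Lemma umulE s t : umul (uclass s) (uclass t) = uclass (UMul s t).
Proof. by apply/uclassE/ueq_mul; apply: urepr_class. Qed.

Lemma uenv_ind (P : uenv -> Prop) : (forall s, P (uclass s)) -> forall u, P u.
Proof. by move=> Ps u; rewrite -[u]ureprK. Qed.

Fact uaddA : associative uadd.
Proof.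
elim/uenv_ind=> s; elim/uenv_ind=> t; elim/uenv_ind=> u.
by rewrite !uaddE; apply/uclassE/ueq_addA.
Qed.
Fact uaddC : commutative uadd.
Proof.
elim/uenv_ind=> s; elim/uenv_ind=> t.
by rewrite !uaddE; apply/uclassE/ueq_addC.
Qed.
Fact uadd0 : left_id (ucst 0) uadd.
Proof. by elim/uenv_ind=> s; rewrite uaddE; apply/uclassE/ueq_add0. Qed.
Fact uaddN : left_inverse (ucst 0) (umul (ucst (-1))) uadd.
Proof. by elim/uenv_ind=> s; rewrite umulE uaddE; apply/uclassE/ueq_addN. Qed.
Fact umulA : associative umul.
Proof.
elim/uenv_ind=> s; elim/uenv_ind=> t; elim/uenv_ind=> u.
by rewrite !umulE; apply/uclassE/ueq_mulA.
Qed.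
Fact umul1l : left_id (ucst 1) umul.
Proof. by elim/uenv_ind=> s; rewrite umulE; apply/uclassE/ueq_mul1l. Qed.
Fact umul1r : right_id (ucst 1) umul.
Proof. by elim/uenv_ind=> s; rewrite umulE; apply/uclassE/ueq_mul1r. Qed.
Fact umulDl : left_distributive umul uadd.
Proof.
elim/uenv_ind=> s; elim/uenv_ind=> t; elim/uenv_ind=> u.
by rewrite ?(uaddE, umulE); apply/uclassE/ueq_mulDl.
Qed.
Fact umulDr : right_distributive umul uadd.
Proof.
elim/uenv_ind=> s; elim/uenv_ind=> t; elim/uenv_ind=> u.
by rewrite ?(uaddE, umulE); apply/uclassE/ueq_mulDr.
Qed.

HB.instance Definition _ :=
  GRing.isZmodule.Build uenv uaddA uaddC uadd0 uaddN.

Definition uscale (a : K) (u : uenv) : uenv := umul (ucst a) u.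

Fact uscaleA a b u : uscale a (uscale b u) = uscale (a * b) u.
Proof.
by rewrite /uscale umulA [ucst (a * b)](uclassE (ueq_cstM a b)) -umulE.
Qed.
Fact uscale1 : left_id 1 uscale.
Proof. exact: umul1l. Qed.
Fact uscaleDr : right_distributive uscale +%R.
Proof. by move=> a u v; apply: umulDr. Qed.
Fact uscaleDl u : {morph uscale^~ u : a b / a + b}.
Proof.
move=> a b; rewrite /uscale [ucst (a + b)](uclassE (ueq_cstD a b)) -uaddE.
exact: umulDl.
Qed.

HB.instance Definition _ := GRing.Zmodule_isLmodule.Build K uenv
  uscaleA uscale1 uscaleDr uscaleDl.

(* The counit, used only to show that 1 != 0 in U(g). *)
Fixpoint ucounit (s : uterm) : K :=
  match s with
  | UGen _ => 0
  | UCst a => a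
  | UAdd s t => ucounit s + ucounit t
  | UMul s t => ucounit s * ucounit t
  end.

Fact ucounit_eq s t : ueq s t -> ucounit s = ucounit t.
Proof.
elim=> {s t} /=.
- by [].
- by move=> s t _ ->.
- by move=> s t u _ -> _ ->.
- by move=> s s' t t' _ -> _ ->.
- by move=> s s' t t' _ -> _ ->.
- by move=> s t u; rewrite addrA.
- by move=> s t; rewrite addrC.
- by move=> s; rewrite add0r.
- by move=> s; rewrite mulN1r addNr.
- by move=> s t u; rewrite mulrA.
- by move=> s; rewrite mul1r.
- by move=> s; rewrite mulr1.
- by move=> s t u; rewrite mulrDl.
- by move=> s t u; rewrite mulrDr.
- by [].
- by [].
- by move=> a s; rewrite mulrC.
- by move=> a _ _; rewrite mulr0 addr0.
- by move=> _ _; rewrite !mulr0 addr0.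
Qed.

Fact uenv1_neq0 : ucst 1 != 0.
Proof.
by apply/eqP=> /uclass_inj/ucounit_eq/eqP; rewrite oner_eq0.
Qed.

HB.instance Definition _ := GRing.Zmodule_isNzRing.Build uenv
  umulA umul1l umul1r umulDl umulDr uenv1_neq0.

Fact uscaleAl a (u v : uenv) : a *: (u * v) = a *: u * v.
Proof. exact: umulA. Qed.

HB.instance Definition _ := GRing.Lmodule_isLalgebra.Build K uenv uscaleAl.

Fact ucstC a (u : uenv) : ucst a * u = u * ucst a.
Proof.
by elim/uenv_ind: u => s; rewrite /GRing.mul /= /ucst !umulE;
  apply/uclassE/ueq_cstC.
Qed.

Fact uscaleAr a (u v : uenv) : a *: (u * v) = u * (a *: v).
Proof.
by rewrite -[LHS]/(ucst a * (u * v)) -[a *: v]/(ucst a * v) !mulrA ucstC.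
Qed.

HB.instance Definition _ := GRing.Lalgebra_isAlgebra.Build K uenv uscaleAr.

Lemma uclassD s t : uclass (UAdd s t) = uclass s + uclass t.
Proof. by rewrite -uaddE. Qed.

Lemma uclassM s t : uclass (UMul s t) = uclass s * uclass t.
Proof. by rewrite -umulE. Qed.

Lemma uclassC a : uclass (UCst a) = a%:A.
Proof. by rewrite -[LHS]umul1r. Qed.

Definition uinj (x : g) : commLie uenv := uclass (UGen x).

Fact uinj_linear : linear uinj.
Proof.
by move=> a x y; rewrite /uinj (uclassE (ueq_genP a x y)) -uaddE -umulE.
Qed.
HB.instance Definition _ :=
  GRing.isLinear.Build K g (commLie uenv) *:%R uinj uinj_linear.

Fact uinj_lie : {morph uinj : x y / [Lie x, y]}.
Proof.
by move=> x y; rewrite /uinj (uclassE (ueq_lie x y)) -uaddE -!umulE.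
Qed.
HB.instance Definition _ :=
  isLieMorphism.Build K g (commLie uenv) uinj uinj_lie.

End UEnv.

Section ULift.
Variables (K : fieldType) (g : lieAlgType K) (A : algType K).
Variable f : lieHom g (commLie A).

Fixpoint ueval (s : uterm g) : A :=
  match s with
  | UGen x => f x
  | UCst a => a%:A
  | UAdd s t => ueval s + ueval t
  | UMul s t => ueval s * ueval t
  end.

Fact ueval_eq s t : ueq s t -> ueval s = ueval t.
Proof.
elim=> {s t} /=.
- by [].
- by move=> s t _ ->.
- by move=> s t u _ -> _ ->.
- by move=> s s' t t' _ -> _ ->.
- by move=> s s' t t' _ -> _ ->.
- by move=> s t u; rewrite addrA.
- by move=> s t; rewrite addrC.
- by move=> s; rewrite scale0r add0r.
- by move=> s; rewrite scaleN1r mulN1r addNr scale0r.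
- by move=> s t u; rewrite mulrA.
- by move=> s; rewrite scale1r mul1r.
- by move=> s; rewrite scale1r mulr1.
- by move=> s t u; rewrite mulrDl.
- by move=> s t u; rewrite mulrDr.
- by move=> a b; rewrite scalerDl.
- by move=> a b; rewrite mulr_algl scalerA.
- by move=> a s; rewrite mulr_algl mulr_algr.
- by move=> a x y; rewrite linearP mulr_algl.
- by move=> x y; rewrite lie_morphism_subproof mulr_algl scaleN1r.
Qed.

Definition ulift (u : uenv g) : A := ueval (urepr u).

Lemma uliftE s : ulift (uclass s) = ueval s.
Proof. exact/ueval_eq/urepr_class. Qed.

Fact ulift_linear : linear ulift.
Proof.
move=> a; elim/uenv_ind=> s; elim/uenv_ind=> t.
rewrite -[a *: _]/(umul (ucst g a) _) -[_ + uclass t]/(uadd _ _).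
by rewrite umulE uaddE !uliftE /= mulr_algl.
Qed.

Fact ulift_monoid_morphism : monoid_morphism ulift.
Proof.
split; first by rewrite -[1]/(uclass (UCst g 1)) uliftE /= scale1r.
elim/uenv_ind=> s; elim/uenv_ind=> t.
by rewrite -[_ * _]/(umul _ _) umulE !uliftE.
Qed.

HB.instance Definition _ :=
  GRing.isLinear.Build K (uenv g) A *:%R ulift ulift_linear.
HB.instance Definition _ :=
  GRing.isMonoidMorphism.Build (uenv g) A ulift ulift_monoid_morphism.

Lemma ulift_inj x : ulift (uinj x) = f x.
Proof. exact: uliftE. Qed.

Lemma ulift_unique (F : {lrmorphism uenv g -> A}) :
  (forall x, F (uinj x) = f x) -> F =1 ulift.
Proof.
move=> Ff; elim/uenv_ind=> s; rewrite uliftE.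
elim: s => [x|a|s IHs t IHt|s IHs t IHt] /=.
- exact: Ff.
- by rewrite uclassC linearZ /= rmorph1.
- by rewrite uclassD raddfD /= IHs IHt.
- by rewrite uclassM rmorphM /= IHs IHt.
Qed.

End ULift.

Definition umap (K : fieldType) (b g : lieAlgType K) (f : lieHom b g) :
    {rmorphism uenv b -> uenv g} :=
  ulift (uinj (g := g) \o f).

(* A g-module structure on the K-vector space V. *)
Record lieRep (K : fieldType) (g : lieAlgType K) (V : lmodType K) := LieRep {
  rep_act :> g -> V -> V;
  rep_linearl : forall v, linear (rep_act^~ v);
  rep_linearr : forall x, linear (rep_act x);
  rep_lie : forall x y v,
    rep_act [Lie x, y] v = rep_act x (rep_act y v) - rep_act y (rep_act x v)
}.

(* g-modules are seen as left U(g)-modules: [repMod rho] is V, on which U(g)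
   acts by the unique extension of the action rho of g. *)
Definition repMod (K : fieldType) (g : lieAlgType K) (V : lmodType K)
  (rho : lieRep g V) : Type := V.

Section RepMod.
Variables (K : fieldType) (g : lieAlgType K) (V : lmodType K).
Variable rho : lieRep g V.

Fixpoint ract (s : uterm g) (v : V) : V :=
  match s with
  | UGen x => rho x v
  | UCst a => a *: v
  | UAdd s t => ract s v + ract t v
  | UMul s t => ract s (ract t v)
  end.

Fact ract_linear s : linear (ract s).
Proof.
elim: s => [x|a|s IHs t IHt|s IHs t IHt] b u v /=.
- exact: rep_linearr.
- by rewrite scalerDr !scalerA mulrC.
- by rewrite IHs IHt scalerDr addrACA.
- by rewrite IHt IHs.
Qed.

Fact ractD s u v : ract s (u + v) = ract s u + ract s v.
Proof. by rewrite -[u in LHS]scale1r ract_linear scale1r. Qed.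

Fact ractZ s a v : ract s (a *: v) = a *: ract s v.
Proof.
have r0 : ract s 0 = 0.
  by apply: (addrI (ract s 0)); rewrite -ractD !addr0.
by rewrite -[a *: v]addr0 ract_linear r0 addr0.
Qed.

Fact ract_eq s t : ueq s t -> ract s =1 ract t.
Proof.
elim=> {s t} /=.
- by [].
- by move=> s t _ st v; rewrite st.
- by move=> s t u _ st _ tu v; rewrite st tu.
- by move=> s s' t t' _ ss _ tt v; rewrite ss tt.
- by move=> s s' t t' _ ss _ tt v; rewrite tt ss.
- by move=> s t u v; rewrite addrA.
- by move=> s t v; rewrite addrC.
- by move=> s v; rewrite scale0r add0r.
- by move=> s v; rewrite scaleN1r addNr scale0r.
- by [].
- by move=> s v; rewrite scale1r.
- by move=> s v; rewrite scale1r.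
- by [].
- by move=> s t u v; rewrite ractD.
- by move=> a b v; rewrite scalerDl.
- by move=> a b v; rewrite scalerA.
- by move=> a s v; rewrite ractZ.
- by move=> a x y v; rewrite rep_linearl.
- by move=> x y v; rewrite rep_lie scaleN1r.
Qed.

Definition rscale (u : uenv g) (v : repMod rho) : repMod rho :=
  ract (urepr u) v.

Lemma rscaleE s v : rscale (uclass s) v = ract s v.
Proof. exact/ract_eq/urepr_class. Qed.

HB.instance Definition _ := GRing.Zmodule.copy (repMod rho) V.

Fact rscaleA a b v : rscale a (rscale b v) = rscale (a * b) v.
Proof.
elim/uenv_ind: a => s; elim/uenv_ind: b => t.
by rewrite -[_ * _]/(umul _ _) umulE !rscaleE.
Qed.
Fact rscale1 : left_id 1 rscale.
Proof. by move=> v; rewrite -[1]/(uclass (UCst g 1)) rscaleE /= scale1r. Qed.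
Fact rscaleDr : right_distributive rscale +%R.
Proof. by move=> a u v; apply: ractD. Qed.
Fact rscaleDl v : {morph rscale^~ v : a b / a + b}.
Proof.
elim/uenv_ind=> s; elim/uenv_ind=> t.
by rewrite -[_ + _]/(uadd _ _) uaddE !rscaleE.
Qed.

HB.instance Definition _ := GRing.Zmodule_isLmodule.Build (uenv g) (repMod rho)
  rscaleA rscale1 rscaleDr rscaleDl.

Lemma repModE x (v : repMod rho) : (uinj x : uenv g) *: v = rho x v.
Proof. exact: rscaleE. Qed.

End RepMod.

(* The module K_chi on which g acts through the character chi. *)
Section CharRep.
Variables (K : fieldType) (g : lieAlgType K).
Variable chi : lieChar g.

Definition char_act (x : g) (k : K^o) : K^o := chi x *: k.

Fact char_linearl k : linear (char_act^~ k).
Proof. by move=> a x y; rewrite /char_act linearP scalerDl scalerA. Qed.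
Fact char_linearr x : linear (char_act x).
Proof. by move=> a u v; rewrite /char_act scalerDr !scalerA mulrC. Qed.
Fact char_lie x y k :
  char_act [Lie x, y] k =
  char_act x (char_act y k) - char_act y (char_act x k).
Proof.
by rewrite /char_act lie_morphism_subproof !scalerA -scalerBl.
Qed.

Definition charRep : lieRep g K^o := LieRep char_linearl char_linearr char_lie.

End CharRep.

Section ExtScalar.
Variables (R A : nzRingType) (f : {rmorphism R -> A}) (V : lmodType R).

(* The tensor product of A (a right R-module through f) and V over R, with its
   left A-module structure: the abelian group generated by the pure tensors
   subject to bilinearity and to a f(r) (x) v = a (x) r v. *)
Inductive tterm : Type :=
| TPure of A & V
| TZero
| TOpp of tterm
| TAdd of tterm & tterm.

Inductive teq : tterm -> tterm -> Prop :=
| teq_refl s : teq s s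
| teq_sym s t : teq s t -> teq t s
| teq_trans s t u : teq s t -> teq t u -> teq s u
| teq_opp s s' : teq s s' -> teq (TOpp s) (TOpp s')
| teq_add s s' t t' : teq s s' -> teq t t' -> teq (TAdd s t) (TAdd s' t')
| teq_addA s t u : teq (TAdd s (TAdd t u)) (TAdd (TAdd s t) u)
| teq_addC s t : teq (TAdd s t) (TAdd t s)
| teq_add0 s : teq (TAdd TZero s) s
| teq_addN s : teq (TAdd (TOpp s) s) TZero
| teq_pureDl a b v : teq (TPure (a + b) v) (TAdd (TPure a v) (TPure b v))
| teq_pureDr a v w : teq (TPure a (v + w)) (TAdd (TPure a v) (TPure a w))
| teq_pureM a r v : teq (TPure (a * f r) v) (TPure a (r *: v)).

HB.instance Definition _ := gen_eqMixin tterm.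
HB.instance Definition _ := gen_choiceMixin tterm.

Definition teqb (s t : tterm) : bool := `[< teq s t >].

Fact teqb_refl : reflexive teqb.
Proof. by move=> s; apply/asboolP; apply: teq_refl. Qed.
Fact teqb_sym : symmetric teqb.
Proof. by move=> s t; apply/asboolP/asboolP; apply: teq_sym. Qed.
Fact teqb_trans : transitive teqb.
Proof.
by move=> t s u /asboolP st /asboolP tu; apply/asboolP; apply: teq_trans tu.
Qed.

Canonical teqb_equiv := EquivRel teqb teqb_refl teqb_sym teqb_trans.

Definition extScalar : Type := {eq_quot teqb}.
HB.instance Definition _ := Choice.on extScalar.

Definition tclass (s : tterm) : extScalar := \pi_{eq_quot teqb} s.
Definition trepr (u : extScalar) : tterm := repr u.

Lemma tclassE s t : teq s t -> tclass s = tclass t.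
Proof. by move=> st; apply/eqmodP/asboolP. Qed.

Lemma tclass_inj s t : tclass s = tclass t -> teq s t.
Proof. by move/eqmodP/asboolP. Qed.

Lemma treprK : cancel trepr tclass.
Proof. exact: reprK. Qed.

Lemma trepr_class s : teq (trepr (tclass s)) s.
Proof. by apply: tclass_inj; rewrite treprK. Qed.

Lemma extScalar_ind (P : extScalar -> Prop) :
  (forall s, P (tclass s)) -> forall u, P u.
Proof. by move=> Ps u; rewrite -[u]treprK. Qed.

Definition tadd (u v : extScalar) := tclass (TAdd (trepr u) (trepr v)).
Definition topp (u : extScalar) := tclass (TOpp (trepr u)).

Lemma taddE s t : tadd (tclass s) (tclass t) = tclass (TAdd s t).
Proof. by apply/tclassE/teq_add; apply: trepr_class. Qed.
Lemma toppE s : topp (tclass s) = tclass (TOpp s).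
Proof. by apply/tclassE/teq_opp; apply: trepr_class. Qed.

Fact taddA : associative tadd.
Proof.
elim/extScalar_ind=> s; elim/extScalar_ind=> t; elim/extScalar_ind=> u.
by rewrite !taddE; apply/tclassE/teq_addA.
Qed.
Fact taddC : commutative tadd.
Proof.
elim/extScalar_ind=> s; elim/extScalar_ind=> t.
by rewrite !taddE; apply/tclassE/teq_addC.
Qed.
Fact tadd0 : left_id (tclass TZero) tadd.
Proof. by elim/extScalar_ind=> s; rewrite taddE; apply/tclassE/teq_add0. Qed.
Fact taddN : left_inverse (tclass TZero) topp tadd.
Proof.
by elim/extScalar_ind=> s; rewrite toppE taddE; apply/tclassE/teq_addN.
Qed.

HB.instance Definition _ :=
  GRing.isZmodule.Build extScalar taddA taddC tadd0 taddN.

Lemma tclassD s t : tclass (TAdd s t) = tclass s + tclass t.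
Proof. by rewrite -taddE. Qed.

Lemma tclassN s : tclass (TOpp s) = - tclass s.
Proof. by rewrite -toppE. Qed.

Fixpoint tact (a : A) (s : tterm) : tterm :=
  match s with
  | TPure b v => TPure (a * b) v
  | TZero => TZero
  | TOpp s => TOpp (tact a s)
  | TAdd s t => TAdd (tact a s) (tact a t)
  end.

Fact tact_eq a s t : teq s t -> teq (tact a s) (tact a t).
Proof.
elim=> {s t} /=; try by [constructor | move=> *; constructor].
- by move=> s t u _ st _ tu; apply: teq_trans tu.
- by move=> b c v; rewrite mulrDr; constructor.
- by move=> b r v; rewrite mulrA; constructor.
Qed.

Definition tscale (a : A) (u : extScalar) : extScalar :=
  tclass (tact a (trepr u)).

Lemma tscaleE a s : tscale a (tclass s) = tclass (tact a s).
Proof. by apply/tclassE/tact_eq; apply: trepr_class. Qed.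

Fact tscaleA a b u : tscale a (tscale b u) = tscale (a * b) u.
Proof.
elim/extScalar_ind: u => s; rewrite !tscaleE; congr tclass.
by elim: s => //= [c v|s ->|s -> t ->] //; rewrite mulrA.
Qed.
Fact tscale1 : left_id 1 tscale.
Proof.
elim/extScalar_ind=> s; rewrite !tscaleE; congr tclass.
by elim: s => //= [c v|s ->|s -> t ->] //; rewrite mul1r.
Qed.
Fact tscaleDr : right_distributive tscale +%R.
Proof.
move=> a; elim/extScalar_ind=> s; elim/extScalar_ind=> t.
by rewrite -![_ + _]/(tadd _ _) taddE !tscaleE taddE.
Qed.
Fact tscaleDl u : {morph tscale^~ u : a b / a + b}.
Proof.
move=> a b; elim/extScalar_ind: u => s; rewrite !tscaleE.
elim: s => [c v||s IHs|s IHs t IHt] /=.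
- rewrite mulrDl -[RHS]/(tadd _ _) taddE; exact/tclassE/teq_pureDl.
- by rewrite [RHS](tadd0 (tclass TZero)).
- by rewrite !tclassN IHs opprD.
- by rewrite !tclassD IHs IHt addrACA.
Qed.

HB.instance Definition _ := GRing.Zmodule_isLmodule.Build A extScalar
  tscaleA tscale1 tscaleDr tscaleDl.

Definition tpure (a : A) (v : V) : extScalar := tclass (TPure a v).

End ExtScalar.

(* U(g) (x)_{U(b)} K_chi, for a character chi of the Lie subalgebra b. *)
Definition indMod (K : fieldType) (g : lieAlgType K) (b : lieSubalg g)
    (chi : lieChar (sublie b)) : lmodType (uenv g) :=
  extScalar (umap (@sublie_incl K g b)) (repMod (charRep chi)).

Definition restrScalar (K : fieldType) (A : algType K) (M : lmodType A) : Type
  := M.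

Section RestrScalar.
Variables (K : fieldType) (A : algType K) (M : lmodType A).

HB.instance Definition _ := GRing.Zmodule.copy (restrScalar M) M.

Let kscale (a : K) (v : restrScalar M) : restrScalar M := (a%:A : A) *: (v : M).

Fact kscaleA a b v : kscale a (kscale b v) = kscale (a * b) v.
Proof. by rewrite /kscale scalerA mulr_algl scalerA. Qed.
Fact kscale1 : left_id 1 kscale.
Proof. by move=> v; rewrite /kscale !scale1r. Qed.
Fact kscaleDr : right_distributive kscale +%R.
Proof. by move=> a u v; rewrite /kscale scalerDr. Qed.
Fact kscaleDl v : {morph kscale^~ v : a b / a + b}.
Proof. by move=> a b; rewrite /kscale !scalerDl. Qed.

HB.instance Definition _ := GRing.Zmodule_isLmodule.Build K (restrScalar M)
  kscaleA kscale1 kscaleDr kscaleDl.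

Lemma restrScalarE a (v : restrScalar M) : a *: v = (a%:A : A) *: (v : M).
Proof. by []. Qed.

Lemma restrScalar_comm a (u : A) (v : M) :
  u *: ((a%:A : A) *: v) = (a%:A : A) *: (u *: v).
Proof. by rewrite !scalerA mulr_algl mulr_algr. Qed.

End RestrScalar.

Section Dual.
Variables (K : fieldType) (V : lmodType K).

Definition is_linear_form : {pred V -> K^o} := [pred f | `[< linear f >]].

Fact is_linear_form_closed : submod_closed is_linear_form.
Proof.
split=> [|a f h /asboolP flin /asboolP hlin]; apply/asboolP.
  by move=> b u v; rewrite scaler0 addr0.
move=> b u v; rewrite -![(a *: f + h) _]/(a *: f _ + h _) flin hlin.
by rewrite !scalerDr !scalerA mulrC addrACA.
Qed.

HB.instance Definition _ := GRing.isSubmodClosed.Build K (V -> K^o)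
  is_linear_form is_linear_form_closed.

(* The full dual space V^*. *)
Record dual : Type :=
  LinearForm { dual_fun :> V -> K^o; _ : dual_fun \in is_linear_form }.

HB.instance Definition _ := [isSub for dual_fun].
HB.instance Definition _ := [Choice of dual by <:].
HB.instance Definition _ := [SubChoice_isSubLmodule of dual by <:].

Fact dual_linear (f : dual) : linear f.
Proof. by case: f => f /= /asboolP. Qed.
HB.instance Definition _ (f : dual) :=
  GRing.isLinear.Build K V K^o *:%R (dual_fun f) (dual_linear f).

End Dual.

Section DualMod.
Variables (K : fieldType) (g : lieAlgType K) (N : lmodType (uenv g)).

Let form : Type := dual (restrScalar N).

Definition codual_fun (x : g) (f : form) (v : restrScalar N) : K^o :=
  f (- ((uinj x : uenv g) *: (v : N))).

Fact codual_fun_linear x f : codual_fun x f \in @is_linear_form K (restrScalar N).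
Proof.
apply/asboolP=> a u v; rewrite /codual_fun.
rewrite -[RHS](linearP (f : {linear restrScalar N -> K^o})).
congr (dual_fun f _).
rewrite !restrScalarE [LHS](_ : _ = - ((uinj x : uenv g) *:
  ((a%:A : uenv g) *: (u : N) + v))) //.
by rewrite scalerDr restrScalar_comm opprD -scalerN.
Qed.

Definition codual_act (x : g) (f : form) : form :=
  LinearForm (codual_fun_linear x f).

Fact codual_linearl f : linear (codual_act^~ f).
Proof.
move=> a x y; apply/val_inj/funext=> v.
rewrite [RHS](_ : _ = a *: codual_fun x f v + codual_fun y f v) //.
rewrite -[RHS](linearP (f : {linear restrScalar N -> K^o})).
rewrite /= /codual_fun; congr (dual_fun f _).
rewrite restrScalarE linearP /= scalerDl opprD; congr (_ + _).
by rewrite scalerN scalerA mulr_algl.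
Qed.

Fact codual_linearr x : linear (codual_act x).
Proof. by move=> a f h; apply/val_inj/funext. Qed.

Fact codual_lie x y f :
  codual_act [Lie x, y] f =
  codual_act x (codual_act y f) - codual_act y (codual_act x f).
Proof.
apply/val_inj/funext=> v.
rewrite [RHS](_ : _ = codual_fun x (codual_act y f) v -
  codual_fun y (codual_act x f) v) //.
rewrite -[RHS](linearB (f : {linear restrScalar N -> K^o})).
rewrite /= /codual_fun; congr (dual_fun f _).
rewrite lie_morphism_subproof.
rewrite [X in - X](_ : _ =
  (uinj x * uinj y - uinj y * uinj x : uenv g) *: (v : N)) //.
by rewrite scalerBl !scalerN !opprK !scalerA opprB.
Qed.

Definition codualRep : lieRep g form :=
  LieRep codual_linearl codual_linearr codual_lie.

(* The full dual N^*, with (x f)(v) = f (- x v) for x in g. *)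
Definition dualMod : lmodType (uenv g) := repMod codualRep.

End DualMod.

Section Submodules.
Variables (A : nzRingType) (M : lmodType A).

Definition simple_module : Prop :=
  (exists v : M, v != 0) /\
  forall S : {pred M}, submod_closed S ->
    {in S, forall v, v = 0} \/ (forall v, v \in S).

Definition annihilator (S : set M) : set A :=
  [set u | forall v, S v -> u *: v = 0].

End Submodules.

Section Independence.
Variables (K : fieldType) (V : lmodType K).

Definition lin_indep (B : set V) : Prop :=
  forall (s : seq V) (c : V -> K), uniq s -> (forall b, b \in s -> B b) ->
    \sum_(b <- s) c b *: b = 0 -> forall b, b \in s -> c b = 0.

Definition lin_span (B : set V) : set V :=
  [set v | exists (s : seq V) (c : V -> K),
     (forall b, b \in s -> B b) /\ v = \sum_(b <- s) c b *: b].

Definition countable_dimension : Prop :=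
  exists B : set V, [/\ countable B, lin_indep B & lin_span B = [set: V]].

End Independence.

Definition add_monoid (V : nmodType) (B : set V) : set V :=
  [set v | exists s : seq V, (forall b, b \in s -> B b) /\ v = \sum_(b <- s) b].

Section Borel.
Variables (K : fieldType) (g : lieAlgType K).

(* Subalgebras h and n, with h abelian, n stable under ad h and h :&: n = 0:
   what is needed to form h (+) n and extend to it the linear forms on h. *)
Record borelPair := BorelPair {
  bp_h : lieSubalg g;
  bp_n : lieSubalg g;
  bp_abelian : {in bp_h &, forall x y, [Lie x, y] = 0};
  bp_stable : forall x y, x \in bp_h -> y \in bp_n -> [Lie x, y] \in bp_n;
  bp_disjoint : forall x, x \in bp_h -> x \in bp_n -> x = 0
}.

Variable p : borelPair.
Let h := bp_h p.
Let n := bp_n p.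

Definition borel_pred : {pred g} :=
  [pred x | `[< exists a, a \in h /\ x - a \in n >]].

Fact borel_submod_closed : submod_closed borel_pred.
Proof.
split=> [|a x y /asboolP[u [hu nu]] /asboolP[v [hv nv]]]; apply/asboolP.
  by exists 0; rewrite subr0 !rpred0.
exists (a *: u + v); split; first by rewrite rpredD ?rpredZ.
by rewrite opprD addrACA -scalerBr rpredD ?rpredZ.
Qed.

Fact borel_bracket (x y a c : g) : a \in h -> c \in h ->
  x - a \in n -> y - c \in n -> [Lie x, y] \in n.
Proof.
move=> ha hc nx ny.
have -> : [Lie x, y] = [Lie x - a, y - c] - [Lie c, x - a] + [Lie a, y - c].
  rewrite -lieC -lieDr subrK; have := lieDl (x - a) a y.
  rewrite subrK => ->; congr (_ + _); have := lieDr (y - c) c a.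
  by rewrite subrK (bp_abelian ha hc) addr0.
apply: rpredD; last exact: bp_stable.
by apply: sublie_rpredB; [apply: lie_closed_subproof | apply: bp_stable].
Qed.

Fact borel_lie_closed : {in borel_pred &, forall x y, [Lie x, y] \in borel_pred}.
Proof.
move=> x y /asboolP[a [ha na]] /asboolP[c [hc nc]]; apply/asboolP.
by exists 0; rewrite subr0 rpred0; split=> //; apply: borel_bracket ha hc na nc.
Qed.

HB.instance Definition _ :=
  GRing.isSubmodClosed.Build K g borel_pred borel_submod_closed.
HB.instance Definition _ :=
  isLieClosed.Build K g borel_pred borel_lie_closed.

Definition borel : lieSubalg g := borel_pred.

Fact borel_dec (x : sublie borel) :
  exists a : sublie h, sublie_val x - sublie_val a \in n.
Proof.
by case: x => x /= /asboolP[a [ha na]]; exists (Sublie ha).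
Qed.

(* The projection of h (+) n onto h. *)
Definition borel_proj (x : sublie borel) : sublie h := sval (cid (borel_dec x)).

Lemma borel_projP x : sublie_val x - sublie_val (borel_proj x) \in n.
Proof. exact: svalP (cid (borel_dec x)). Qed.

Lemma borel_proj_unique (x : sublie borel) (a : sublie h) :
  sublie_val x - sublie_val a \in n -> borel_proj x = a.
Proof.
move=> xa; apply/val_inj/eqP; rewrite -subr_eq0; apply/eqP/(@bp_disjoint p).
  by rewrite sublie_rpredB ?(valP a) ?(valP (borel_proj x)).
have -> : \val (borel_proj x) - \val a =
    (sublie_val x - sublie_val a) - (sublie_val x - sublie_val (borel_proj x)).
  by rewrite opprB [RHS]addrC subrKA.
by rewrite sublie_rpredB ?borel_projP.
Qed.

(* The linear form mu on h, extended by 0 on n. *)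
Definition borel_char_fun (mu : dual (sublie h)) (x : sublie borel) :
  commLie (K^o : algType K) := mu (borel_proj x).

Variable mu : dual (sublie h).

Fact borel_char_linear : linear (borel_char_fun mu).
Proof.
move=> a x y; rewrite /borel_char_fun -linearP; congr (mu _).
apply: borel_proj_unique => /=.
by rewrite opprD addrACA -scalerBr rpredD ?rpredZ ?borel_projP.
Qed.
HB.instance Definition _ := GRing.isLinear.Build K (sublie borel)
  (commLie (K^o : algType K)) *:%R (borel_char_fun mu) borel_char_linear.

Fact borel_char_lie : {morph borel_char_fun mu : x y / [Lie x, y]}.
Proof.
move=> x y; rewrite -[RHS]/(mu _ * mu _ - mu _ * mu _) mulrC subrr.
rewrite -[RHS](linear0 (dual_fun mu)); congr (mu _).
apply: borel_proj_unique; rewrite subr0.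
by apply: (borel_bracket (valP (borel_proj x)) (valP (borel_proj y)));
  apply: borel_projP.
Qed.
HB.instance Definition _ := isLieMorphism.Build K (sublie borel)
  (commLie (K^o : algType K)) (borel_char_fun mu) borel_char_lie.

Definition borelChar : lieChar (sublie borel) := borel_char_fun mu.

End Borel.

Section WeightSpace.
Variables (K : fieldType) (g : lieAlgType K) (h n : lieSubalg g).

Definition weight_space (alpha : dual (sublie h)) : set g :=
  [set y | y \in n /\
     forall x : sublie h, [Lie sublie_val x, y] = alpha x *: y].

Definition weight_graded : Prop :=
  (forall y, y \in n -> exists (s : seq (dual (sublie h))) (f : _ -> g),
     [/\ uniq s, forall alpha, alpha \in s -> weight_space alpha (f alpha)
       & y = \sum_(alpha <- s) f alpha]) /\
  (forall (s : seq (dual (sublie h))) (f : _ -> g), uniq s ->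
     (forall alpha, alpha \in s -> weight_space alpha (f alpha)) ->
     \sum_(alpha <- s) f alpha = 0 -> forall alpha, alpha \in s -> f alpha = 0).

End WeightSpace.

Section Triangular.
Variables (K : fieldType) (g : lieAlgType K).

Record triangular := Triangular {
  tri_nm : lieSubalg g;
  tri_h : lieSubalg g;
  tri_np : lieSubalg g;
  tri_sum : forall x, exists a b c,
    [/\ a \in tri_nm, b \in tri_h, c \in tri_np & x = a + b + c];
  tri_direct : forall a b c, a \in tri_nm -> b \in tri_h -> c \in tri_np ->
    a + b + c = 0 -> [/\ a = 0, b = 0 & c = 0];
  tri_nm_neq0 : exists2 x, x \in tri_nm & x != 0;
  tri_h_neq0 : exists2 x, x \in tri_h & x != 0;
  tri_np_neq0 : exists2 x, x \in tri_np & x != 0;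
  tri_h_abelian : {in tri_h &, forall x y, [Lie x, y] = 0};
  tri_nm_stable : forall x y, x \in tri_h -> y \in tri_nm ->
    [Lie x, y] \in tri_nm;
  tri_np_stable : forall x y, x \in tri_h -> y \in tri_np ->
    [Lie x, y] \in tri_np;
  tri_np_graded : weight_graded tri_h tri_np;
  (* The linearly independent set generating the monoid Q_+. *)
  tri_base : set (dual (sublie tri_h));
  tri_base_indep : lin_indep tri_base;
  tri_np_weights : forall alpha,
    (exists2 y, weight_space tri_np alpha y & y != 0) ->
    add_monoid tri_base alpha /\ alpha != 0;
  tri_sigma : {linear g -> g};
  tri_sigma_lie : forall x y,
    tri_sigma [Lie x, y] = [Lie tri_sigma y, tri_sigma x];
  tri_sigma_invol : involutive tri_sigma;
  tri_sigma_np : tri_sigma @` [set x | x \in tri_np] = [set x | x \in tri_nm];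
  tri_sigma_h : {in tri_h, forall x, tri_sigma x = x}
}.

Variable t : triangular.

Fact tri_disjoint_np x : x \in tri_h t -> x \in tri_np t -> x = 0.
Proof.
move=> hx nx; have Nnx := sublie_rpredN nx.
have x0 : 0 + x - x = 0 by rewrite add0r subrr.
by have [] := tri_direct (rpred0 _) hx Nnx x0.
Qed.

Fact tri_disjoint_nm x : x \in tri_h t -> x \in tri_nm t -> x = 0.
Proof.
move=> hx nx; have Nnx := sublie_rpredN nx.
have x0 : - x + x + 0 = 0 by rewrite addr0 addNr.
by have [] := tri_direct Nnx hx (rpred0 _) x0.
Qed.

Definition borel_plus : borelPair g :=
  BorelPair (@tri_h_abelian t) (@tri_np_stable t) tri_disjoint_np.
Definition borel_minus : borelPair g :=
  BorelPair (@tri_h_abelian t) (@tri_nm_stable t) tri_disjoint_nm.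

(* M(mu) *)
Definition verma (mu : dual (sublie (tri_h t))) : lmodType (uenv g) :=
  indMod (borelChar (p := borel_plus) mu).

(* N(mu), generated by a lowest weight vector of weight mu *)
Definition lowest_verma (mu : dual (sublie (tri_h t))) : lmodType (uenv g) :=
  indMod (borelChar (p := borel_minus) mu).

(* M_lambda *)
Definition whittaker (lambda : lieChar (sublie (tri_np t))) :
  lmodType (uenv g) := indMod lambda.

(* The set L is L(lambda, mu), the image of the nonzero homomorphism from
   M_lambda to N(-mu)^*, which is unique up to a scalar. *)
Definition is_Lmod (lambda : lieChar (sublie (tri_np t)))
    (mu : dual (sublie (tri_h t))) (L : set (dualMod (lowest_verma (- mu)))) :=
  exists2 phi : {linear whittaker lambda -> dualMod (lowest_verma (- mu))},
    exists v, phi v != 0 & L = range phi.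

End Triangular.

(* Main.v *)
(* Write N = N(-mu). A u in U(g) acts on N^* as the transpose of the action on
   N of its image under the principal anti-automorphism. When N is simple, the
   orthogonal in N of a nonzero submodule L of N^* is zero, so u kills L as soon
   as, and only if, it kills all of N^*: every nonzero submodule of N^* has the
   same annihilator. This applies to L(lambda, mu), and to the image of a nonzero
   homomorphism from M(mu) to N^*, which is injective as M(mu) is simple.

   The simplicity of N follows from that of M(mu), because N is M(mu) twisted by
   the automorphism - sigma of g. A homomorphism from M(mu) to N^* amounts to
   a linear form on N that kills n_+ N and has weight mu; its existence does not
   require the Poincare-Birkhoff-Witt theorem: N is the sum of the line of its
   generator, which is nonzero as N is, and of the span of the other weight
   vectors, and these are independent because the weights of n_+ lie in a
   monoid without nonzero opposite elements. *)

Require Import Defs.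
From HB Require Import structures.
From mathcomp Require Import all_boot all_order all_algebra.
From mathcomp Require Import boolp classical_sets functions cardinality reals.
From mathcomp Require Import complex.

Set Implicit Arguments.
Unset Strict Implicit.
Unset Printing Implicit Defensive.

Import GRing.Theory.
Local Open Scope ring_scope.
Local Open Scope classical_set_scope.

(** * Induction on elements of U(g); scalars of K enter as central elements [a%:A] *)

Section Enveloping.
Variables (K : fieldType) (g : lieAlgType K).

Definition ugen (x : g) : uenv g := uinj x.

Lemma ugenD x y : ugen (x + y) = ugen x + ugen y.
Proof. exact: linearD. Qed.

Lemma ugenN x : ugen (- x) = - ugen x.
Proof. exact: linearN. Qed.

Lemma ugen_lie x y : ugen [Lie x, y] = ugen x * ugen y - ugen y * ugen x.
Proof. exact: uinj_lie. Qed.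

Lemma uenv_gen_ind (P : uenv g -> Prop) :
    (forall x, P (ugen x)) -> (forall a, P a%:A) ->
    (forall u v, P u -> P v -> P (u + v)) ->
    (forall u v, P u -> P v -> P (u * v)) ->
  forall u, P u.
Proof.
move=> Pgen Pcst Padd Pmul; elim/uenv_ind; elim=> [x|a|s Ps t Pt|s Ps t Pt].
- exact: Pgen.
- by rewrite uclassC.
- by rewrite uclassD; apply: Padd.
- by rewrite uclassM; apply: Pmul.
Qed.

Lemma scalarC a (u : uenv g) : u * a%:A = a%:A * u.
Proof. by rewrite mulr_algl mulr_algr. Qed.

Lemma scalarC_act (X : lmodType (uenv g)) a (u : uenv g) (v : X) :
  u *: (a%:A *: v) = a%:A *: (u *: v).
Proof. by rewrite !scalerA scalarC. Qed.

End Enveloping.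

Section UMap.
Variables (K : fieldType) (g1 g2 : lieAlgType K) (f : lieHom g1 g2).

Lemma umap_gen x : umap f (ugen x) = ugen (f x).
Proof. exact: ulift_inj. Qed.

Lemma umap_scalar (a : K) : umap f a%:A = a%:A.
Proof. by rewrite [LHS]linearZ rmorph1. Qed.

End UMap.

(** * Generator and universal property of induced modules *)

Section Induced.
Variables (K : fieldType) (g : lieAlgType K) (b : lieSubalg g).
Variable chi : lieChar (sublie b).

Definition ind_gen : indMod chi :=
  @tclass _ _ (umap (@sublie_incl K g b)) (repMod (charRep chi))
    (TPure 1 ((1 : K) : repMod (charRep chi))).

Lemma char_scalarE (a : K) (k : repMod (charRep chi)) :
  (a%:A : uenv (sublie b)) *: k = a *: (k : K^o).
Proof. by rewrite -uclassC; apply: rscaleE. Qed.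

Lemma umap_incl (y : sublie b) :
  umap (@sublie_incl K g b) (ugen y) = ugen (sublie_val y).
Proof. exact: umap_gen. Qed.

(** The vector [k] is the scalar [k%:A] of U(b) applied to 1, so it crosses the tensor sign. *)
Lemma ind_pure (u : uenv g) (k : repMod (charRep chi)) :
  tclass (umap (@sublie_incl K g b)) (TPure u k) = (u * (k : K)%:A) *: ind_gen.
Proof.
rewrite [RHS]tscaleE /= mulr1 -(umap_scalar (@sublie_incl K g b) (k : K)).
rewrite (tclassE (teq_pureM _ _ _ _)) char_scalarE.
by congr (tclass _ (TPure _ _)); apply/esym/mulr1.
Qed.

Lemma ind_cyclic (m : indMod chi) : exists u, m = u *: ind_gen.
Proof.
elim/extScalar_ind: m; elim=> [u k||s [u us]|s [u us] t [v vt]].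
- by rewrite ind_pure; eexists.
- by exists 0; rewrite scale0r.
- by exists (- u); rewrite tclassN us scaleNr.
- by exists (u + v); rewrite tclassD us vt scalerDl.
Qed.

Lemma ind_gen_char (y : sublie b) :
  ugen (sublie_val y) *: ind_gen = ((chi y : K)%:A : uenv g) *: ind_gen.
Proof.
rewrite [LHS]tscaleE /= mulr1 -umap_incl -[umap _ _]mul1r.
rewrite (tclassE (teq_pureM _ _ _ _)) repModE ind_pure mul1r.
congr (_%:A *: _); exact: mulr1.
Qed.

Section Lift.
Variables (A : nzRingType) (theta : {rmorphism uenv g -> A}).
Variables (X : lmodType A) (x : X).
Hypothesis x_char : forall y : sublie b,
  theta (ugen (sublie_val y)) *: x = theta (chi y : K)%:A *: x.

(** The lift is semilinear along [theta]: the identity gives module homomorphisms, an automorphism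
    of U(g) gives maps to twisted modules. *)
Fixpoint tlift (s : tterm (uenv g) (repMod (charRep chi))) : X :=
  match s with
  | TPure u k => theta (u * (k : K)%:A) *: x
  | TZero => 0
  | TOpp s => - tlift s
  | TAdd s t => tlift s + tlift t
  end.

(** The relation [x_char] propagates from generators through sums and products of U(b); [k] stays
    arbitrary because the product case needs it at [s *: k]. This is what makes [tlift] compatible
    with the balancing relation. *)
Lemma umap_char (r : uenv (sublie b)) (k : repMod (charRep chi)) :
  theta (umap (@sublie_incl K g b) r * (k : K)%:A) *: x =
  theta (r *: k : K)%:A *: x.
Proof.
elim/uenv_gen_ind: r k => [y|a|r s IHr IHs|r s IHr IHs] k.
- rewrite umap_incl repModE scalarC rmorphM -scalerA x_char scalerA.
  by rewrite -rmorphM mulr_algl scalerA mulrC.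
- by rewrite umap_scalar mulr_algl scalerA char_scalarE.
- rewrite rmorphD mulrDl rmorphD scalerDl IHr IHs -scalerDl -rmorphD scalerDl.
  by congr (theta _ *: _); apply/esym/scalerDl.
- rewrite [umap _ _]rmorphM -mulrA rmorphM -scalerA IHs scalerA.
  by rewrite -rmorphM IHr -[(_ * _) *: k]scalerA.
Qed.

Lemma tlift_eq s t : teq (umap (@sublie_incl K g b)) s t -> tlift s = tlift t.
Proof.
elim=> {s t} /=.
- by [].
- by move=> s t _ ->.
- by move=> s t u _ -> _ ->.
- by move=> s s' _ ->.
- by move=> s s' t t' _ -> _ ->.
- by move=> s t u; rewrite addrA.
- by move=> s t; rewrite addrC.
- by move=> s; rewrite add0r.
- by move=> s; rewrite addNr.
- by move=> u v k; rewrite mulrDl rmorphD scalerDl.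
- by move=> u k l; rewrite scalerDl mulrDr rmorphD scalerDl.
- move=> u r k; rewrite -mulrA rmorphM -scalerA umap_char scalerA.
  by rewrite -rmorphM.
Qed.

Definition ind_lift (m : indMod chi) : X := tlift (trepr m).

Lemma ind_liftE s : ind_lift (tclass _ s) = tlift s.
Proof. exact/tlift_eq/trepr_class. Qed.

Lemma ind_liftD : {morph ind_lift : m n / m + n}.
Proof.
elim/extScalar_ind=> s; elim/extScalar_ind=> t.
by rewrite -tclassD !ind_liftE.
Qed.

Lemma ind_liftZ u m : ind_lift (u *: m) = theta u *: ind_lift m.
Proof.
elim/extScalar_ind: m => s; rewrite [u *: _]tscaleE !ind_liftE.
elim: s => [v k||s IHs|s IHs t IHt] /=.
- by rewrite -mulrA rmorphM scalerA.
- by rewrite scaler0.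
- by rewrite IHs scalerN.
- by rewrite IHs IHt scalerDr.
Qed.

Lemma ind_lift_gen : ind_lift ind_gen = x.
Proof. by rewrite ind_liftE /= mul1r scale1r rmorph1 scale1r. Qed.

End Lift.
End Induced.

(** * Annihilators of submodules of N^* *)

Section DualAnnihilator.
Variables (K : fieldType) (g : lieAlgType K) (N : lmodType (uenv g)).
Implicit Types (f : dualMod N) (v : N).

Definition ev f v : K := dual_fun (f : dual (restrScalar N)) v.

Lemma ev_inj f f' : ev f =1 ev f' -> f = f'.
Proof. by move=> ff'; apply/(@val_inj _ _ (dual _))/funext => v; apply: ff'. Qed.

Lemma ev0l v : ev 0 v = 0.
Proof. by []. Qed.

Lemma evDl f f' v : ev (f + f') v = ev f v + ev f' v.
Proof. by []. Qed.

Lemma ev_scalarl a f v : ev (a%:A *: f) v = a * ev f v.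
Proof. by rewrite -uclassC [_ *: f]rscaleE. Qed.

Lemma evDr f v w : ev f (v + w) = ev f v + ev f w.
Proof. exact: (raddfD (f : dual (restrScalar N))). Qed.

Lemma ev0r f : ev f 0 = 0.
Proof. exact: (raddf0 (f : dual (restrScalar N))). Qed.

Lemma evNr f v : ev f (- v) = - ev f v.
Proof. exact: (raddfN (f : dual (restrScalar N))). Qed.

Lemma ev_scalarr a f v : ev f (a%:A *: v) = a * ev f v.
Proof. 
have := dual_linear (f : dual (restrScalar N)) a (v : restrScalar N) 0.
by rewrite addr0 [X in _ = _ + X]ev0r addr0. Qed.

Lemma ev_gen x f v : ev (ugen x *: f) v = - ev f (ugen x *: v).
Proof. by rewrite -evNr [_ *: f]repModE. Qed.

(* u' stands for the image of u under the principal anti-automorphism. *)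
Lemma adjoint_exists (u : uenv g) : exists u' : uenv g,
  (forall f v, ev (u *: f) v = ev f (u' *: v)) /\
  (forall f v, ev f (u *: v) = ev (u' *: f) v).
Proof.
elim/uenv_gen_ind: u => [x|a|u w [u' [u1 u2]] [w' [w1 w2]]|
  u w [u' [u1 u2]] [w' [w1 w2]]].
- exists (ugen (- x)); split=> f v.
    by rewrite ev_gen ugenN scaleNr evNr.
  by rewrite ev_gen ugenN scaleNr evNr opprK.
- by exists a%:A; split=> f v; rewrite ev_scalarl ev_scalarr.
- exists (u' + w'); split=> f v.
    by rewrite !scalerDl evDl evDr u1 w1.
  by rewrite !scalerDl evDl evDr u2 w2.
- exists (w' * u'); split=> f v.
    by rewrite -!scalerA u1 w1.
  by rewrite -!scalerA u2 w2.
Qed.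

Lemma ann_dual_stable (L : set (dualMod N)) :
    simple_module N -> (forall u f, L f -> L (u *: f)) ->
    (exists2 f, L f & f != 0) ->
  annihilator L = annihilator [set: dualMod N].
Proof.
move=> [_ N_simple] Lstable [f0 Lf0 f0_neq0].
pose orth := [pred v : N | `[< forall f, L f -> ev f v = 0 >]].
have orth_closed : submod_closed orth.
  split=> [|u v w /asboolP vL /asboolP wL]; apply/asboolP=> f Lf.
    exact: ev0r.
  (* Moving [u] across the pairing replaces [f] by [u' *: f], which is again in [L]. *)
  have [u' [_ u'E]] := adjoint_exists u.
  by rewrite evDr u'E vL ?wL ?addr0 //; apply: Lstable.
have {N_simple} orth0 : forall v, v \in orth -> v = 0.
  have [//|orthT] := N_simple _ orth_closed.
  case/eqP: f0_neq0; apply: ev_inj => v.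
  by have /asboolP/(_ _ Lf0) := orthT v.
apply/seteqP; split=> u uL f; last by move=> _; apply: uL.
have [u' [u'E _]] := adjoint_exists u.
move=> _; apply: ev_inj => v; rewrite ev0l u'E.
(* [u' *: v] is orthogonal to each [h] in [L]: this pairing is that of [u *: h = 0] with [v]. *)
rewrite (orth0 (u' *: v)) ?ev0r //; apply/asboolP=> h Lh.
by rewrite -u'E uL.
Qed.

End DualAnnihilator.

(** * Verma modules and the Chevalley twist exchanging M(mu) and N(-mu) *)

Section BorelInduced.
Variables (K : fieldType) (g : lieAlgType K) (p : borelPair g).
Variable mu : dual (sublie (bp_h p)).

Lemma borel_gen_act (a : sublie (bp_h p)) (x : g) :
    x - sublie_val a \in bp_n p ->
  ugen x *: ind_gen (borelChar mu) =
  ((mu a : K)%:A : uenv g) *: ind_gen (borelChar mu).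
Proof.
move=> xa; have xb : x \in borel p.
  by apply/asboolP; exists (sublie_val a); split=> //; apply: (valP a).
rewrite -[x]/(sublie_val (Sublie xb)) ind_gen_char.
by rewrite /= /borel_char_fun (@borel_proj_unique _ _ _ _ a).
Qed.

Lemma borel_gen_h (a : sublie (bp_h p)) :
  ugen (sublie_val a) *: ind_gen (borelChar mu) =
  ((mu a : K)%:A : uenv g) *: ind_gen (borelChar mu).
Proof. by apply: borel_gen_act; rewrite subrr rpred0. Qed.

Lemma borel_gen_n (x : g) :
  x \in bp_n p -> ugen x *: ind_gen (borelChar mu) = 0.
Proof.
move=> nx; rewrite (@borel_gen_act 0) ?subr0 // (raddf0 mu) scale0r.
exact: scale0r.
Qed.

End BorelInduced.

Section Twist.
Variables (K : fieldType) (g : lieAlgType K) (t : triangular g).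

(** The sign turns the anti-automorphism into a Lie automorphism, which swaps n_+ and n_- and is -1
    on h. *)
Definition chevalley (x : g) : g := - tri_sigma t x.

Fact chevalley_linear : linear chevalley.
Proof. by move=> a x y; rewrite /chevalley linearP opprD scalerN. Qed.
HB.instance Definition _ :=
  GRing.isLinear.Build K g g *:%R chevalley chevalley_linear.

Fact chevalley_lie : {morph chevalley : x y / [Lie x, y]}.
Proof.
have lieNl (u v : g) : [Lie - u, v] = - [Lie u, v].
  apply/eqP; rewrite -addr_eq0 -lieDl addNr; apply/eqP.
  by apply: (addrI [Lie 0, v]); rewrite -lieDl !addr0.
move=> x y; rewrite /chevalley tri_sigma_lie -lieC.
by rewrite [RHS]lieNl [X in _ = - X]lieC [X in _ = - - X]lieNl opprK -lieC.
Qed.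
HB.instance Definition _ :=
  isLieMorphism.Build K g g chevalley chevalley_lie.

Lemma chevalleyK : involutive chevalley.
Proof. by move=> x; rewrite /chevalley linearN tri_sigma_invol opprK. Qed.

Lemma chevalley_np x : x \in tri_np t -> chevalley x \in tri_nm t.
Proof.
move=> nx; apply: sublie_rpredN.
have : [set z | z \in tri_nm t] (tri_sigma t x).
  by rewrite -tri_sigma_np; exists x.
by [].
Qed.

Lemma chevalley_nm x : x \in tri_nm t -> chevalley x \in tri_np t.
Proof.
move=> nx; apply: sublie_rpredN.
have : [set z | z \in tri_nm t] x by [].
by rewrite -tri_sigma_np => -[y ny <-]; rewrite tri_sigma_invol.
Qed.

Lemma chevalley_h (a : sublie (tri_h t)) :
  chevalley (sublie_val a) = sublie_val (- a).
Proof. by rewrite /chevalley tri_sigma_h // (valP a). Qed.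

Definition uchevalley : {rmorphism uenv g -> uenv g} := umap chevalley.

Lemma uchevalleyK : involutive uchevalley.
Proof.
elim/uenv_gen_ind=> [x|a|u v IHu IHv|u v IHu IHv].
- by rewrite /uchevalley !umap_gen /= chevalleyK.
- by rewrite /uchevalley !umap_scalar.
- by rewrite !rmorphD IHu IHv.
- by rewrite !rmorphM IHu IHv.
Qed.

Lemma lowest_verma_simple (mu : dual (sublie (tri_h t))) :
  simple_module (verma mu) -> simple_module (lowest_verma (- mu)).
Proof.
set M := verma mu; set N := lowest_verma (- mu).
pose m0 : M := ind_gen _; pose n0 : N := ind_gen _.
(* Through the twist [n0] has highest weight mu: n_+ acts as n_-, hence by zero, and [a] acts as
   [- a], where -mu takes the value mu(a). *)
have n0_char (y : sublie (borel (borel_plus t))) :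
    uchevalley (ugen (sublie_val y)) *: n0 =
    uchevalley (borelChar (p := borel_plus t) mu y : K)%:A *: n0.
  have yP := borel_projP y; set a := borel_proj y in yP.
  rewrite /uchevalley umap_gen umap_scalar.
  rewrite (@borel_gen_act _ _ (borel_minus t) _ (- a)).
    congr (_%:A *: _); rewrite [LHS]/(- mu (- a)) (raddfN mu).
    exact: opprK.
  by rewrite -[sublie_val (- a)]chevalley_h -linearB; apply: chevalley_np.
have m0_char (y : sublie (borel (borel_minus t))) :
    uchevalley (ugen (sublie_val y)) *: m0 =
    uchevalley (borelChar (p := borel_minus t) (- mu) y : K)%:A *: m0.
  have yP := borel_projP y; set a := borel_proj y in yP.
  rewrite /uchevalley umap_gen umap_scalar.
  rewrite (@borel_gen_act _ _ (borel_plus t) _ (- a)).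
    congr (_%:A *: _); exact: (raddfN mu).
  by rewrite -[sublie_val (- a)]chevalley_h -linearB; apply: chevalley_nm.
pose F : M -> N := ind_lift uchevalley n0.
pose G : N -> M := ind_lift uchevalley m0.
have FZ u m : F (u *: m) = uchevalley u *: F m by apply: ind_liftZ.
have GZ u n : G (u *: n) = uchevalley u *: G n by apply: ind_liftZ.
have Fm0 : F m0 = n0 by apply: ind_lift_gen.
have Gn0 : G n0 = m0 by apply: ind_lift_gen.
have FK n : F (G n) = n.
  by have [u ->] := ind_cyclic n; rewrite GZ FZ Gn0 Fm0 uchevalleyK.
have GK m : G (F m) = m.
  by have [u ->] := ind_cyclic m; rewrite FZ GZ Fm0 Gn0 uchevalleyK.
have FD : {morph F : x y / x + y} by apply: ind_liftD.
have F0 : F 0 = 0 by rewrite -(scale0r 0) FZ rmorph0 scale0r.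
case=> -[m m_neq0] M_simple; split.
  exists (F m); apply: contra m_neq0 => /eqP Fm.
  by rewrite -[m]GK Fm -F0 GK.
(* The preimage of a submodule under the semilinear [F] is a submodule, so simplicity travels along
   the bijection. *)
move=> S [S0 Slin]; pose T := [pred m | F m \in S].
have T_closed : submod_closed T.
  by split=> [|u x y]; rewrite !inE ?F0 // FD FZ; apply: Slin.
have [T0|TT] := M_simple _ T_closed; [left=> n Sn | right=> n].
  have Gn : G n \in T by rewrite inE FK.
  by rewrite -[n]FK (T0 _ Gn) F0.
by rewrite -[n]FK; apply: TT.
Qed.

End Twist.

(** * Independence of weight vectors and positivity of weights *)

Section Weights.
Variables (K : fieldType) (g : lieAlgType K) (h n : lieSubalg g).
Variable X : lmodType (uenv g).
Implicit Types (chi alpha : dual (sublie h)) (v w : X).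

Definition weight_vector chi w : Prop :=
  forall a : sublie h,
    ugen (sublie_val a) *: w = ((chi a : K)%:A : uenv g) *: w.

Lemma scalar_eq0 (c : K) v : (c%:A : uenv g) *: v = 0 -> v != 0 -> c = 0.
Proof.
move=> cv0 v_neq0; apply/eqP; apply: contraNT v_neq0 => c_neq0.
have -> : v = ((c^-1)%:A : uenv g) *: ((c%:A : uenv g) *: v).
  by rewrite scalerA mulr_algl scalerA mulVf // !scale1r.
by rewrite cv0 scaler0.
Qed.

Lemma weight_vectorZ chi (c : K) v :
  weight_vector chi v -> weight_vector chi ((c%:A : uenv g) *: v).
Proof. by move=> wv a; rewrite scalarC_act wv scalarC_act. Qed.

Lemma weight_vectorM alpha chi x w : weight_space n alpha x ->
  weight_vector chi w -> weight_vector (alpha + chi) (ugen x *: w).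
Proof.
move=> [_ wx] ww a; rewrite scalerA.
have -> : ugen (sublie_val a) * ugen x =
    (alpha a : K)%:A * ugen x + ugen x * ugen (sublie_val a).
  rewrite -[LHS](subrK (ugen x * ugen (sublie_val a))) -ugen_lie wx.
  by rewrite mulr_algl; congr (_ + _); apply: linearZ.
rewrite scalerDl -[(_ * ugen x) *: w]scalerA -[(ugen x * _) *: w]scalerA ww.
rewrite scalarC_act -scalerDl; congr (_ *: _).
exact/esym/scalerDl.
Qed.

(* Applying a - chi_1(a) to a vanishing sum of weight vectors removes the
   summand of weight chi_1 and rescales the others. *)
Lemma weight_vector_indep (s : seq (dual (sublie h) * X)) chi v :
    weight_vector chi v ->
    (forall i, i \in s -> i.1 != chi /\ weight_vector i.1 i.2) ->
  v + \sum_(i <- s) i.2 = 0 -> v = 0.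
Proof.
have [m] := ubnP (size s); elim: m => // m IHm in s v *.
case: s => [|[psi w] s] /= sm wv s_chi; first by rewrite big_nil addr0.
have [/= psi_chi ww] := s_chi (psi, w) (mem_head _ _).
have [a a_psi] : exists a, psi a != chi a.
  apply: contrapT => /forallNP psiE; case/eqP: psi_chi.
  by apply/val_inj/funext => a; apply/eqP; apply: contrapT => /negP /psiE.
rewrite big_cons => vws0.
pose A : uenv g := ugen (sublie_val a) - (psi a : K)%:A.
have AE chi' u : weight_vector chi' u ->
    A *: u = ((chi' a - psi a : K)%:A : uenv g) *: u.
  by move=> wu; rewrite /A !scalerBl wu.
pose s' := [seq (i.1, A *: i.2) | i <- s].
have Av0 : A *: v = 0.
  apply: (IHm s'); first by rewrite size_map.
  - by rewrite (AE chi) //; apply: weight_vectorZ.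
  - move=> _ /mapP[i si ->] /=.
    have [i_chi wi] : i.1 != chi /\ weight_vector i.1 i.2.
      by apply: s_chi; rewrite inE si orbT.
    by split=> //; rewrite (AE i.1) //; apply: weight_vectorZ.
  - rewrite big_map /= -scaler_sumr.
    have : A *: (v + (w + \sum_(i <- s) i.2)) = 0 by rewrite vws0 scaler0.
    rewrite addrCA !scalerDr.
    by rewrite (AE psi w ww) subrr !scale0r add0r.
apply/eqP; apply: contraNT a_psi => v_neq0.
rewrite eq_sym -subr_eq0; apply/eqP/(scalar_eq0 _ v_neq0).
by rewrite -(AE chi).
Qed.

End Weights.

(** Grouping repetitions gives a combination of distinct elements of [B] whose coefficients are
    positive integers, nonzero in characteristic 0. *)
Lemma sum_indep_neq0 (K : fieldType) (V : lmodType K) (B : set V) (s : seq V) :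
    [pchar K] =i pred0 -> lin_indep B -> (forall b, b \in s -> B b) ->
  s != [::] -> \sum_(b <- s) b != 0.
Proof.
move=> charK Bindep sB; case: s sB => // b s sB _; apply/eqP => sum0.
have cb0 : (count_mem b (b :: s))%:R = 0 :> K.
  apply: (Bindep (undup (b :: s)) (fun x => (count_mem x (b :: s))%:R)).
  - exact: undup_uniq.
  - by move=> x; rewrite mem_undup; apply: sB.
  - rewrite -[RHS]sum0 -[RHS]big_undup_iterop_count; apply: eq_bigr => x _.
    by rewrite scaler_nat.
  - by rewrite mem_undup mem_head.
move/eqP: cb0; have /pcharf0P -> := charK.
by rewrite /= eqxx.
Qed.

(** * The coefficient of the lowest weight vector as a linear form *)

Section LowestVermaForm.
Variables (K : fieldType) (g : lieAlgType K) (t : triangular g).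
Hypothesis charK : [pchar K] =i pred0.
Variable nu : dual (sublie (tri_h t)).

Let N := lowest_verma nu.
Let n0 : N := ind_gen _.

Lemma lowest_gen_weight : weight_vector nu n0.
Proof. by move=> a; apply: (@borel_gen_h _ _ (borel_minus t)). Qed.

Definition pos_weight (beta : dual (sublie (tri_h t))) : Prop :=
  add_monoid (@tri_base _ _ t) beta /\ beta != 0.

(** The concatenated list of base elements is nonempty, and independence of the base prevents
    cancellation. *)
Lemma pos_weightD alpha beta :
  pos_weight alpha -> pos_weight beta -> pos_weight (alpha + beta).
Proof.
move=> [[s [sB ->]] s_neq0] [[s' [sB' ->]] _].
have catB b : b \in s ++ s' -> @tri_base _ _ t b.
  by rewrite mem_cat => /orP[]; [apply: sB | apply: sB'].
rewrite -big_cat; split; first by exists (s ++ s').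
apply: (sum_indep_neq0 charK (@tri_base_indep _ _ t) catB).
by apply: contraNneq s_neq0; case: s {sB catB} => // _; rewrite big_nil.
Qed.

(** This stands for the sum of the weight spaces of N above nu. A list of pairs lets weights repeat,
    so that adding is concatenating. *)
Definition upper_part (p : N) : Prop :=
  exists s : seq (dual (sublie (tri_h t)) * N),
    (forall i, i \in s -> pos_weight i.1 /\ weight_vector (i.1 + nu) i.2) /\
    p = \sum_(i <- s) i.2.

Lemma upper_part0 : upper_part 0.
Proof. by exists [::]; rewrite big_nil. Qed.

Lemma upper_part1 beta w :
  pos_weight beta -> weight_vector (beta + nu) w -> upper_part w.
Proof.
move=> pb ww; exists [:: (beta, w)]; rewrite big_seq1; split=> // i.
by rewrite inE => /eqP ->.
Qed.

Lemma upper_partD p q : upper_part p -> upper_part q -> upper_part (p + q).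
Proof.
move=> [s [sP ->]] [s' [sP' ->]]; exists (s ++ s'); rewrite big_cat.
by split=> // i; rewrite mem_cat => /orP[]; [apply: sP | apply: sP'].
Qed.

Lemma upper_part_sum (I : eqType) (s : seq I) (F : I -> N) :
  (forall i, i \in s -> upper_part (F i)) -> upper_part (\sum_(i <- s) F i).
Proof.
by move=> sF; rewrite big_seq; apply: big_ind sF;
  [apply: upper_part0 | apply: upper_partD].
Qed.

Lemma upper_part_stable (u : uenv g) :
    (forall beta w, pos_weight beta -> weight_vector (beta + nu) w ->
       upper_part (u *: w)) ->
  forall p, upper_part p -> upper_part (u *: p).
Proof.
move=> uP p [s [sP ->]]; rewrite scaler_sumr; apply: upper_part_sum => i si.
by have [pi wi] := sP i si; apply: uP pi wi.
Qed.

Lemma upper_partZ (c : K) p :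
  upper_part p -> upper_part ((c%:A : uenv g) *: p).
Proof.
apply: upper_part_stable => beta w pb ww.
by apply: upper_part1 pb _; apply: weight_vectorZ.
Qed.

Lemma upper_part_h (a : sublie (tri_h t)) p :
  upper_part p -> upper_part (ugen (sublie_val a) *: p).
Proof.
apply: upper_part_stable => beta w pb ww.
by rewrite ww; apply: upper_part1 pb _; apply: weight_vectorZ.
Qed.

(** Each nonzero weight component of [x] adds a positive alpha to weights: [n0] moves to alpha + nu,
    the other vectors to alpha + beta + nu, still above nu. *)
Lemma upper_part_np x (c : K) p : x \in tri_np t -> upper_part p ->
  upper_part (ugen x *: ((c%:A : uenv g) *: n0 + p)).
Proof.
move=> nx up; have [np_sum _] := tri_np_graded t.
have [s [f [_ fs ->]]] := np_sum _ nx.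
have -> : ugen (\sum_(alpha <- s) f alpha) = \sum_(alpha <- s) ugen (f alpha).
  exact: raddf_sum.
rewrite scaler_suml; apply: upper_part_sum => alpha /fs wx.
(* A zero component says nothing about alpha: [tri_np_weights] speaks of nonzero weight vectors
   only. *)
have [x0|x_neq0] := eqVneq (f alpha) 0.
  by rewrite x0 [ugen 0](raddf0 (@uinj K g)) scale0r; apply: upper_part0.
have pa : pos_weight alpha by apply: tri_np_weights; exists (f alpha).
rewrite scalerDr; apply: upper_partD.
  apply: upper_part1 pa _; apply: weight_vectorM wx _; apply: weight_vectorZ.
  exact: lowest_gen_weight.
apply: upper_part_stable up => beta w pb ww.
apply: upper_part1 (pos_weightD pa pb) _; rewrite -addrA.
exact: weight_vectorM wx _.
Qed.

(** This is U(n_+) n0, given inductively so that stability under g is proved by induction on how a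
    vector is built. *)
Inductive np_span : N -> Prop :=
| np_span_gen (c : K) : np_span ((c%:A : uenv g) *: n0)
| np_spanD v w : np_span v -> np_span w -> np_span (v + w)
| np_spanM x v : x \in tri_np t -> np_span v -> np_span (ugen x *: v).

Lemma np_span_act x v : np_span v -> np_span (ugen x *: v).
Proof.
move=> vspan; elim: vspan x => {v} [c|v w _ IHv _ IHw|x v nx vspan IHv] y.
- have [a [b [x [na hb nx ->]]]] := tri_sum t y.
  rewrite !ugenD !scalerDl; apply: np_spanD; last first.
    by apply: np_spanM => //; apply: np_span_gen.
  rewrite scalarC_act (@borel_gen_n _ _ (borel_minus t)) // scaler0 add0r.
  rewrite scalarC_act (lowest_gen_weight (Sublie hb)) scalerA mulr_algl scalerA.
  exact: np_span_gen.
- by rewrite scalerDr; apply: np_spanD; [apply: IHv | apply: IHw].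
(* Here y x v = [y, x] v + x y v, and the induction hypothesis, valid for all of g, covers both
   [y, x] and y. *)
- rewrite scalerA -[_ * _](subrK (ugen x * ugen y)) -ugen_lie scalerDl -scalerA.
  by apply: np_spanD; [apply: IHv | apply: np_spanM].
Qed.

Lemma np_spanT v : np_span v.
Proof.
have [u ->] := ind_cyclic v; rewrite -[ind_gen _]/n0.
have : np_span n0 by rewrite -[n0]scale1r -(scale1r 1); apply: np_span_gen.
(* The vector is generalised from [n0] because the product case applies [u] to [w *: m]. *)
elim/uenv_gen_ind: u n0 => [x|c|u w IHu IHw|u w IHu IHw] m m_span.
- exact: np_span_act.
- elim: m_span => {m} [d|m m' _ IHm _ IHm'|x m nx _ IHm].
  + by rewrite scalerA mulr_algl scalerA; apply: np_span_gen.
  + by rewrite scalerDr; apply: np_spanD.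
  + by rewrite -scalarC_act; apply: np_spanM.
- by rewrite scalerDl; apply: np_spanD; [apply: IHu | apply: IHw].
- by rewrite -scalerA; apply/IHu/IHw.
Qed.

Lemma lowest_decomp (v : N) :
  exists c : K, upper_part (v - (c%:A : uenv g) *: n0).
Proof.
elim: (np_spanT v) => {v} [c|v w _ [c cv] _ [d dw]|x v nx _ [c cv]].
- by exists c; rewrite subrr; apply: upper_part0.
- exists (c + d); rewrite scalerDl scalerDl opprD addrACA.
  exact: upper_partD.
- exists 0; rewrite scale0r scale0r subr0.
  by rewrite -(subrK ((c%:A : uenv g) *: n0) v) addrC; apply: upper_part_np.
Qed.

Definition lowest_form (v : N) : K := sval (cid (lowest_decomp v)).

Hypothesis N_neq0 : exists v : N, v != 0.

(** If [d] is the chosen coefficient, (d - c) n0 has weight nu and lies in the upper part, so it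
    vanishes by independence; [n0] is nonzero as it generates a nonzero module. *)
Lemma lowest_formE v (c : K) :
  upper_part (v - (c%:A : uenv g) *: n0) -> lowest_form v = c.
Proof.
rewrite /lowest_form; case: cid => d /= dv cv.
have n0_neq0 : n0 != 0.
  have [m] := N_neq0; have [u ->] := ind_cyclic m.
  by apply: contraNneq => n00; rewrite -[ind_gen _]/n0 n00 scaler0.
apply/eqP; rewrite -subr_eq0; apply/eqP/(scalar_eq0 _ n0_neq0).
have : upper_part (- (((d - c)%:A : uenv g) *: n0)).
  have := upper_partD dv (upper_partZ (-1) cv).
  rewrite !scaleN1r opprB addrC subrKA scalerBl -opprB => up.
  by rewrite scalerBl.
case=> s [sP sE].
apply: (@weight_vector_indep _ _ _ _ [seq (i.1 + nu, i.2) | i <- s] nu).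
- by apply: weight_vectorZ; apply: lowest_gen_weight.
- move=> _ /mapP[i si ->] /=; have [[_ i_neq0] wi] := sP i si; split=> //.
  by rewrite -subr_eq0 addrK.
- by rewrite big_map /= -sE subrr.
Qed.

Fact lowest_form_linear :
  (lowest_form : restrScalar N -> K^o) \in is_linear_form (V := restrScalar N).
Proof.
apply/asboolP=> a v w.
apply: lowest_formE.
have := upper_partD (upper_partZ a (svalP (cid (lowest_decomp v))))
  (svalP (cid (lowest_decomp w))).
congr upper_part; rewrite scalerDl [in RHS]scalerDl opprD addrACA; congr (_ + _).
by rewrite scalerBr scalerA mulr_algl scalerA.
Qed.

Definition lowest_dual : dualMod N := LinearForm lowest_form_linear.

Lemma lowest_dual_gen : ev lowest_dual n0 = 1.
Proof.
by apply: lowest_formE; rewrite !scale1r subrr; apply: upper_part0.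
Qed.

Lemma lowest_dual_np x v : x \in tri_np t -> ev lowest_dual (ugen x *: v) = 0.
Proof.
move=> nx; apply: lowest_formE; rewrite !scale0r subr0.
have [c cv] := lowest_decomp v.
by rewrite -(subrK ((c%:A : uenv g) *: n0) v) addrC; apply: upper_part_np.
Qed.

Lemma lowest_dual_h (a : sublie (tri_h t)) v :
  ev lowest_dual (ugen (sublie_val a) *: v) = nu a * ev lowest_dual v.
Proof.
apply: lowest_formE.
have := upper_part_h a (svalP (cid (lowest_decomp v))).
congr upper_part; rewrite scalerBr scalarC_act (lowest_gen_weight a) scalerA.
by rewrite mulr_algl scalerA mulrC.
Qed.

(** [lowest_dual] is a highest weight vector of weight mu: the form vanishes on n_+ N, and the sign
    in the dual action turns nu into mu. *)
Lemma verma_hom (mu : dual (sublie (tri_h t))) : nu = - mu ->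
  exists F : verma mu -> dualMod N, [/\ {morph F : v w / v + w},
    forall u v, F (u *: v) = u *: F v & exists v, F v != 0].
Proof.
move=> nuE.
have F_char (y : sublie (borel (borel_plus t))) :
    idfun (ugen (sublie_val y)) *: lowest_dual =
    idfun (borelChar (p := borel_plus t) mu y : K)%:A *: lowest_dual.
  have yP := borel_projP y; set a := borel_proj y in yP.
  apply: ev_inj => v; rewrite ev_gen ev_scalarl.
  rewrite -(subrK (sublie_val a) (sublie_val y)) ugenD scalerDl evDr.
  rewrite lowest_dual_np // add0r lowest_dual_h nuE -mulNr; congr (_ * _).
  exact: opprK.
exists (ind_lift idfun lowest_dual); split.
- exact: ind_liftD.
- exact: ind_liftZ.
exists (ind_gen _); rewrite ind_lift_gen //.
apply/eqP => /(congr1 (fun f => ev f n0)); rewrite lowest_dual_gen ev0l.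
by apply/eqP/oner_neq0.
Qed.

End LowestVermaForm.

(** * Comparison of the two annihilators through N^* *)

Theorem theorem39 (R : realType) (g : lieAlgType R[i])
    (g_countable : countable_dimension g) (t : triangular g)
    (mu : dual (sublie (tri_h t))) (lambda : lieChar (sublie (tri_np t)))
    (M_simple : simple_module (verma mu))
    (L : set (dualMod (lowest_verma (- mu)))) (L_def : is_Lmod lambda L) :
  annihilator L = annihilator [set: verma mu].
Proof.
have N_simple := lowest_verma_simple M_simple.
have [[n n_neq0] _] := N_simple.
have charC : [pchar R[i]] =i pred0 by apply: Num.Theory.pchar_num.
have [F [FD FZ [m Fm_neq0]]] :=
  verma_hom charC (ex_intro _ n n_neq0) (erefl (- mu)).
have F0 : F 0 = 0 by rewrite -(scale0r 0) FZ scale0r.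
(* The kernel of [F] is a submodule missing [m], hence zero. *)
have F_inj v : F v = 0 -> v = 0.
  move=> Fv0; have [_ /(_ [pred w | F w == 0])] := M_simple.
  case=> [|ker0|kerT]; last by case/negP: Fm_neq0; apply: kerT.
    split=> [|u x y /eqP Fx /eqP Fy]; apply/eqP; first exact: F0.
    by rewrite FD FZ Fx Fy scaler0 addr0.
  by apply: ker0; apply/eqP.
have -> : annihilator L = annihilator (range F).
  (* Both [L] and [range F] are stable under U(g) and contain a nonzero form. *)
  transitivity (annihilator [set: dualMod (lowest_verma (- mu))]).
    case: L_def => phi [v phiv_neq0] ->; apply: ann_dual_stable => //.
      by move=> u _ [w _ <-]; exists (u *: w) => //; apply: linearZ.
    by exists (phi v) => //; exists v.
  apply/esym/ann_dual_stable => //; last by exists (F m) => //; exists m.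
  by move=> u _ [w _ <-]; exists (u *: w).
apply/seteqP; split=> u uann v.
  by move=> _; apply: F_inj; rewrite FZ; apply: uann; exists v.
by case=> w _ <-; rewrite -FZ uann.
Qed.
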